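(* The maximal rank of tensors in $\mathbb{C}^{2\times2\times2\times2}$ (rank taken over $\mathbb{C}$) is equal to $4$, and the typical rank of $\mathbb{C}^{2\times2\times2\times2}$ is equal to $4$ (that is, $4$ is a typical rank and it is the only one).
   Context: A rank one tensor is an outer product of nonzero vectors; the rank over $\mathbb{C}$ of a tensor is the smallest $s\ge0$ such that it is a sum of $s$ rank one complex tensors. The maximal rank is the maximum of the ranks of all tensors in the space. An integer $r$ is a typical rank of $\mathbb{C}^{2\times2\times2\times2}$ if the set of tensors of rank exactly $r$ contains a nonempty open subset (Euclidean topology). *)

(* Defs.v *)
From HB Require Import structures.
From mathcomp Require Import all_boot all_order all_algebra.
From mathcomp Require Import complex.
From mathcomp Require Import all_classical all_reals all_analysis.

Set Implicit Arguments.
Unset Strict Implicit.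
Unset Printing Implicit Defensive.

Import Order.TTheory GRing.Theory Num.Theory.
Import numFieldNormedType.Exports.
(* function types carry the topology of pointwise convergence: on tensors, whose
   index sets are finite, this is the Euclidean topology *)
Import ArrowAsProduct.

Local Open Scope classical_set_scope.
Local Open Scope ring_scope.
Local Open Scope complex_scope.

Definition tensor (K : fieldType) (n1 n2 n3 n4 : nat) : Type :=
  'I_n1 -> 'I_n2 -> 'I_n3 -> 'I_n4 -> K.

Section Rank.
Variables (K : fieldType) (n1 n2 n3 n4 : nat).
Implicit Types T : tensor K n1 n2 n3 n4.

Definition outer (a : 'rV[K]_n1) (b : 'rV[K]_n2) (c : 'rV[K]_n3)
    (d : 'rV[K]_n4) : tensor K n1 n2 n3 n4 :=
  fun i j k l => a 0 i * b 0 j * c 0 k * d 0 l.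

Definition rank_one T : Prop :=
  exists (a : 'rV[K]_n1) (b : 'rV[K]_n2) (c : 'rV[K]_n3) (d : 'rV[K]_n4),
    [/\ a != 0, b != 0, c != 0 & d != 0] /\ T = outer a b c d.

Definition sum_of_rank_one T (s : nat) : Prop :=
  exists X : 'I_s -> tensor K n1 n2 n3 n4,
    (forall q, rank_one (X q)) /\
    forall i j k l, T i j k l = \sum_(q < s) X q i j k l.

Lemma sum_of_rank_one_ex T : exists s, `[< sum_of_rank_one T s >].
Proof.
pose I := ('I_n1 * 'I_n2 * 'I_n3 * 'I_n4)%type.
pose t (x : I) := T x.1.1.1 x.1.1.2 x.1.2 x.2.
pose r := enum [pred x | t x != 0].
exists (size r); apply/asboolP.
pose Y (x : I) := outer (t x *: delta_mx 0 x.1.1.1) (delta_mx 0 x.1.1.2)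
  (delta_mx 0 x.1.2) (delta_mx 0 x.2).
exists (fun q => Y (tnth (in_tuple r) q)); split.
  move=> q; set x := tnth _ q.
  have tx : t x != 0 by have := mem_tnth q (in_tuple r); rewrite mem_enum.
  have d0 n (i : 'I_n) : (delta_mx 0 i : 'rV[K]_n) != 0.
    apply/eqP => /rowP/(_ i); rewrite !mxE !eqxx /= => /eqP.
    by rewrite oner_eq0.
  exists (t x *: delta_mx 0 x.1.1.1), (delta_mx 0 x.1.1.2), (delta_mx 0 x.1.2),
    (delta_mx 0 x.2); split=> //; split=> //.
  by rewrite scaler_eq0 (negbTE tx) d0.
move=> i j k l.
have -> : \sum_(q < size r) Y (tnth (in_tuple r) q) i j k l
    = \sum_(x <- r) Y x i j k l by rewrite (big_tnth _ _ r).
rewrite big_enum /= big_mkcond (bigD1 (i, j, k, l)) //= big1 ?addr0.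
  rewrite /Y /outer !mxE !eqxx /= !mulr1 -/(t (i, j, k, l)).
  by case: ifPn => [//|]; rewrite inE negbK => /eqP.
move=> [[[i' j'] k'] l'] ne; case: ifP => // _.
rewrite /Y /outer !mxE /= (eq_sym i) (eq_sym j) (eq_sym k) (eq_sym l).
move: ne; rewrite !xpair_eqE !negb_and.
by case/orP=> [/orP[/orP[|]|]|] /negbTE ->; rewrite ?(mulr0, mul0r).
Qed.

Definition trank T : nat := ex_minn (sum_of_rank_one_ex T).

End Rank.

Definition is_maximal_rank (K : fieldType) (n1 n2 n3 n4 m : nat) : Prop :=
  (forall T : tensor K n1 n2 n3 n4, (trank T <= m)%N) /\
  (exists T : tensor K n1 n2 n3 n4, trank T = m).

(* the normed topology is found by inference on R[i]^o, not on R[i] *)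
Definition is_typical_rank (R : realType) (n1 n2 n3 n4 r : nat) : Prop :=
  exists U : set (tensor R[i]^o n1 n2 n3 n4),
    [/\ open U, U !=set0 & U `<=` [set T | trank T = r]].

(* Main.v *)
From HB Require Import structures.
From mathcomp Require Import all_boot all_order all_algebra.
From mathcomp Require Import complex.
From mathcomp Require Import all_classical all_reals all_analysis.
From mathcomp Require Import ring.
Require Import Defs.

(**
A 2x2x2x2 tensor [T] is a pencil [A + t B] of 2x2x2 tensors, and a 2x2x2 tensor with
nonzero hyperdeterminant has rank at most 2; so [T] has rank at most 4 as soon as two
members of the pencil have nonzero hyperdeterminant. Otherwise the hyperdeterminant
vanishes on the whole pencil, along each of the four factors. If moreover some slice has
rank 3, it is equivalent to [W = e001 + e010 + e100], and the vanishing forces [T], after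
a change of basis, to be either [a e0000 + e1 * W] or a tensor supported on the indices
of weight 2; both are decomposed explicitly.

A tensor of rank at most 3 has a singular 4x4 flattening; the tensors with nonsingular
flattening are open, and dense because [T + t I] is nonsingular for all but finitely many [t].
*)

Set Implicit Arguments.
Unset Strict Implicit.
Unset Printing Implicit Defensive.

Import Order.TTheory GRing.Theory Num.Theory.
Import numFieldNormedType.Exports.
Import ArrowAsProduct.

(** * Rank bounds over a field: sums, permutations and linear changes of the factors *)

Section RankAtMost.
Local Open Scope ring_scope.
Variable K : fieldType.
Implicit Types (T U : tensor K 2 2 2 2) (B : 'I_2 -> 'I_2 -> 'I_2 -> K).
Implicit Types (g : 'M[K]_2).

Lemma ord2P (P : 'I_2 -> Prop) : P 0 -> P 1 -> forall i, P i.
Proof.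
move=> P0 P1 [[|[|//]] i2].
  by rewrite (_ : Ordinal i2 = 0) //; apply: val_inj.
by rewrite (_ : Ordinal i2 = 1) //; apply: val_inj.
Qed.

Lemma tensor2P (P : 'I_2 -> 'I_2 -> 'I_2 -> 'I_2 -> Prop) :
  P 0 0 0 0 -> P 0 0 0 1 -> P 0 0 1 0 -> P 0 0 1 1 ->
  P 0 1 0 0 -> P 0 1 0 1 -> P 0 1 1 0 -> P 0 1 1 1 ->
  P 1 0 0 0 -> P 1 0 0 1 -> P 1 0 1 0 -> P 1 0 1 1 ->
  P 1 1 0 0 -> P 1 1 0 1 -> P 1 1 1 0 -> P 1 1 1 1 ->
  forall i j k l, P i j k l.
Proof.
by move=> ????????????????; do 4! elim/ord2P.
Qed.

Lemma sum2E (V : nmodType) (F : 'I_2 -> V) : \sum_q F q = F 0 + F 1.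
Proof.
rewrite !big_ord_recl big_ord0 addr0; congr (F _ + F _); exact: val_inj.
Qed.

Definition vec2 (a b : K) : 'rV[K]_2 := \row_i (if i == 0 then a else b).

Lemma vec2E a b : (vec2 a b 0 0 = a) * (vec2 a b 0 1 = b).
Proof. by rewrite /vec2 !mxE. Qed.

(** Zero vectors are allowed, so the bound passes through every linear map on a factor, invertible
    or not. *)
Definition rank_le s T := exists a b c d : 'I_s -> 'rV[K]_2,
  forall i j k l, T i j k l = \sum_q outer (a q) (b q) (c q) (d q) i j k l.

Definition rank3_le s B := exists b c d : 'I_s -> 'rV[K]_2,
  forall j k l, B j k l = \sum_q b q 0 j * c q 0 k * d q 0 l.

Lemma rank_le_outer a b c d : rank_le 1 (outer a b c d).
Proof.
exists (fun=> a), (fun=> b), (fun=> c), (fun=> d) => i j k l.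
by rewrite big_ord1.
Qed.

Lemma rank_leD s t T U V : rank_le s T -> rank_le t U ->
  (forall i j k l, V i j k l = T i j k l + U i j k l) -> rank_le (s + t) V.
Proof.
move=> [a [b [c [d hT]]]] [a' [b' [c' [d' hU]]]] hV.
pose m (f : 'I_s -> 'rV[K]_2) f' (q : 'I_(s + t)) :=
  match fintype.split q with inl q => f q | inr q => f' q end.
exists (m a a'), (m b b'), (m c c'), (m d d') => i j k l.
rewrite hV hT hU big_split_ord /= /m.
congr (_ + _); apply: eq_bigr => q _.
  by have := unsplitK (inl q : 'I_s + 'I_t) => /= ->.
by have := unsplitK (inr q : 'I_s + 'I_t) => /= ->.
Qed.

Lemma rank_le_ext s T U : rank_le s T ->
  (forall i j k l, U i j k l = T i j k l) -> rank_le s U.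
Proof.
by move=> [a [b [c [d hT]]]] e; exists a, b, c, d => *; rewrite e hT.
Qed.

Lemma rank_le_vec_rank3_le s (a : 'rV[K]_2) B T : rank3_le s B ->
  (forall i j k l, T i j k l = a 0 i * B j k l) -> rank_le s T.
Proof.
move=> [b [c [d hB]]] e; exists (fun=> a), b, c, d => i j k l.
by rewrite e hB mulr_sumr; apply: eq_bigr => q _; rewrite /outer !mulrA.
Qed.

Lemma rank_le_swap12 s T : rank_le s T -> rank_le s (fun i j k l => T j i k l).
Proof.
move=> [a [b [c [d hT]]]]; exists b, a, c, d => i j k l.
by rewrite hT; apply: eq_bigr => q _; rewrite /outer (mulrC (a q 0 j)).
Qed.

Lemma rank_le_swap23 s T : rank_le s T -> rank_le s (fun i j k l => T i k j l).
Proof.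
move=> [a [b [c [d hT]]]]; exists a, c, b, d => i j k l.
by rewrite hT; apply: eq_bigr => q _; rewrite /outer; congr (_ * _); rewrite mulrAC.
Qed.

Lemma rank_le_swap34 s T : rank_le s T -> rank_le s (fun i j k l => T i j l k).
Proof.
move=> [a [b [c [d hT]]]]; exists a, b, d, c => i j k l.
by rewrite hT; apply: eq_bigr => q _; rewrite /outer mulrAC.
Qed.

Lemma rank_le_flip1 s T : rank_le s (fun i => if i == 0 then T 1 else T 0) -> rank_le s T.
Proof.
move=> [a [b [c [d hT]]]].
exists (fun q => vec2 (a q 0 1) (a q 0 0)), b, c, d.
elim/ord2P => j k l.
  by have /= -> := hT 1 j k l; apply: eq_bigr => q _; rewrite /outer vec2E.
by have /= -> := hT 0 j k l; apply: eq_bigr => q _; rewrite /outer vec2E.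
Qed.

Definition act1 g B : 'I_2 -> 'I_2 -> 'I_2 -> K :=
  fun j k l => \sum_j' g j j' * B j' k l.
Definition act2 g B : 'I_2 -> 'I_2 -> 'I_2 -> K :=
  fun j k l => \sum_k' g k k' * B j k' l.
Definition act3 g B : 'I_2 -> 'I_2 -> 'I_2 -> K :=
  fun j k l => \sum_l' g l l' * B j k l'.

Lemma rank_le_act1 s g T : rank_le s T -> rank_le s (fun i => act1 g (T i)).
Proof.
move=> [a [b [c [d hT]]]]; exists a, (fun q => b q *m g^T), c, d => i j k l.
rewrite /act1; under eq_bigr do rewrite hT mulr_sumr.
rewrite exchange_big /=; apply: eq_bigr => q _.
rewrite /outer mxE mulr_sumr !mulr_suml; apply: eq_bigr => j' _.
by rewrite !mxE; ring.
Qed.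

Lemma rank_le_act2 s g T : rank_le s T -> rank_le s (fun i => act2 g (T i)).
Proof.
move=> [a [b [c [d hT]]]]; exists a, b, (fun q => c q *m g^T), d => i j k l.
rewrite /act2; under eq_bigr do rewrite hT mulr_sumr.
rewrite exchange_big /=; apply: eq_bigr => q _.
rewrite /outer mxE mulr_sumr !mulr_suml; apply: eq_bigr => j' _.
by rewrite !mxE; ring.
Qed.

Lemma rank_le_act3 s g T : rank_le s T -> rank_le s (fun i => act3 g (T i)).
Proof.
move=> [a [b [c [d hT]]]]; exists a, b, c, (fun q => d q *m g^T) => i j k l.
rewrite /act3; under eq_bigr do rewrite hT mulr_sumr.
rewrite exchange_big /=; apply: eq_bigr => q _.
rewrite /outer mxE mulr_sumr; apply: eq_bigr => j' _.
by rewrite !mxE; ring.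
Qed.

Lemma rank_le_shear1 s t T : rank_le s T ->
  rank_le s (fun i j k l => T i j k l + (if i == 0 then t * T 1 j k l else 0)).
Proof.
move=> [a [b [c [d hT]]]].
exists (fun q => vec2 (a q 0 0 + t * a q 0 1) (a q 0 1)), b, c, d => i j k l.
elim/ord2P: i; rewrite /= ?addr0 !hT ?mulr_sumr -?big_split /=.
  by apply: eq_bigr => q _; rewrite /outer !vec2E; ring.
by apply: eq_bigr => q _; rewrite /outer !vec2E.
Qed.

Lemma act1VK g B : g \in unitmx -> act1 (invmx g) (act1 g B) = B.
Proof.
move=> gu; apply/funext => j; apply/funext => k; apply/funext => l.
rewrite /act1; under eq_bigr do rewrite mulr_sumr.
rewrite exchange_big /=.
transitivity (\sum_i (invmx g *m g) j i * B i k l).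
  apply: eq_bigr => i _; rewrite mxE mulr_suml; apply: eq_bigr => q _.
  by rewrite mulrA.
rewrite mulVmx // (bigD1 j) //= big1 ?addr0 ?mxE ?eqxx ?mul1r // => i ij.
by rewrite mxE eq_sym (negbTE ij) mul0r.
Qed.

Lemma act2VK g B : g \in unitmx -> act2 (invmx g) (act2 g B) = B.
Proof.
move=> gu; apply/funext => j; apply/funext => k; apply/funext => l.
exact: (congr1 (fun F => F k j l) (act1VK (fun k j l => B j k l) gu)).
Qed.

Lemma act3VK g B : g \in unitmx -> act3 (invmx g) (act3 g B) = B.
Proof.
move=> gu; apply/funext => j; apply/funext => k; apply/funext => l.
exact: (congr1 (fun F => F l k j) (act1VK (fun l k j => B j k l) gu)).
Qed.

Lemma rank_le_act1_inv s g T : g \in unitmx ->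
  rank_le s (fun i => act1 g (T i)) -> rank_le s T.
Proof.
move=> gu /(rank_le_act1 (invmx g)) h; apply: (rank_le_ext h) => i j k l.
by rewrite act1VK.
Qed.

Lemma rank_le_act2_inv s g T : g \in unitmx ->
  rank_le s (fun i => act2 g (T i)) -> rank_le s T.
Proof.
move=> gu /(rank_le_act2 (invmx g)) h; apply: (rank_le_ext h) => i j k l.
by rewrite act2VK.
Qed.

Lemma rank_le_act3_inv s g T : g \in unitmx ->
  rank_le s (fun i => act3 g (T i)) -> rank_le s T.
Proof.
move=> gu /(rank_le_act3 (invmx g)) h; apply: (rank_le_ext h) => i j k l.
by rewrite act3VK.
Qed.

(** A nonzero entry of the first row serves as pivot; if that row vanishes, the second row alone
    gives the factorization. *)
Lemma det_zero_outer (D : 'I_2 -> 'I_2 -> K) : D 0 0 * D 1 1 = D 0 1 * D 1 0 ->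
  exists y z : 'rV[K]_2, forall j k, D j k = y 0 j * z 0 k.
Proof.
move=> h; have [d0|d0] := eqVneq (D 0 0) 0; last first.
  exists (vec2 1 (D 1 0 / D 0 0)), (vec2 (D 0 0) (D 0 1)).
  elim/ord2P; elim/ord2P; rewrite !vec2E ?mul1r ?divfK //.
  by rewrite mulrAC [_ * D 0 1]mulrC -h mulrC mulKf.
have [d1|d1] := eqVneq (D 0 1) 0.
  exists (vec2 0 1), (vec2 (D 1 0) (D 1 1)).
  by elim/ord2P; elim/ord2P; rewrite !vec2E ?mul1r ?mul0r.
exists (vec2 1 (D 1 1 / D 0 1)), (vec2 (D 0 0) (D 0 1)).
elim/ord2P; elim/ord2P; rewrite !vec2E ?mul1r ?divfK //.
rewrite d0 mulr0; move: h; rewrite d0 mul0r => /esym/eqP.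
by rewrite mulf_eq0 (negbTE d1) => /eqP.
Qed.

Lemma rank_le_prod_mx (P N : 'I_2 -> 'I_2 -> K) T :
  P 0 0 * P 1 1 = P 0 1 * P 1 0 -> N 0 0 * N 1 1 = N 0 1 * N 1 0 ->
  (forall i j k l, T i j k l = P i j * N k l) -> rank_le 1 T.
Proof.
move=> /det_zero_outer[a [b hP]] /det_zero_outer[c [d hN]] e.
apply: (rank_le_ext (rank_le_outer a b c d)) => i j k l.
by rewrite e hP hN /outer !mulrA.
Qed.

End RankAtMost.

(** * 2x2x2 tensors: the hyperdeterminant and the normal form [w_tensor] *)

Section RankAtMostFour.
Local Open Scope ring_scope.
Variable K : numClosedFieldType.
Implicit Types (T : tensor K 2 2 2 2) (B : 'I_2 -> 'I_2 -> 'I_2 -> K).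

Definition mx2 (a b c d : K) : 'M[K]_2 :=
  \matrix_(i, j) (if i == 0 then if j == 0 then a else b
                  else if j == 0 then c else d).

Lemma mx2E a b c d : (mx2 a b c d 0 0 = a) * (mx2 a b c d 0 1 = b) *
  (mx2 a b c d 1 0 = c) * (mx2 a b c d 1 1 = d).
Proof. by rewrite /mx2 !mxE. Qed.

Lemma mx2_unit a b c d : (mx2 a b c d \in unitmx) = (a * d - b * c != 0).
Proof.
rewrite unitmxE unitfE (expand_det_row _ 0) sum2E /cofactor !det_mx11 !mxE /=.
by rewrite expr0 expr1 mul1r mulN1r mulrN.
Qed.

(* the polarization of [2 det]: [polar C C = 2 det C], so [hyperdet B] is the discriminant
   of the binary quadratic form [det (u B0 + v B1)] *)
Definition polar (C D : 'I_2 -> 'I_2 -> K) : K :=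
  C 0 0 * D 1 1 + C 1 1 * D 0 0 - C 0 1 * D 1 0 - C 1 0 * D 0 1.

Definition hyperdet B : K :=
  polar (B 0) (B 1) ^+ 2 - polar (B 0) (B 0) * polar (B 1) (B 1).

Lemma polar_eq0 (C : 'I_2 -> 'I_2 -> K) :
  polar C C = 0 -> C 0 0 * C 1 1 = C 0 1 * C 1 0.
Proof.
rewrite /polar => h; apply/eqP; rewrite -subr_eq0; apply/eqP.
apply: (mulfI (_ : 2%:R != 0)); first by rewrite pnatr_eq0.
by rewrite mulr0 -h; ring.
Qed.

Lemma rank3_le_pencil (x y : 'rV[K]_2) (C D : 'I_2 -> 'I_2 -> K) B :
  polar C C = 0 -> polar D D = 0 ->
  (forall j k l, B j k l = x 0 j * C k l + y 0 j * D k l) -> rank3_le 2 B.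
Proof.
move=> /polar_eq0/det_zero_outer[u [v hC]] /polar_eq0/det_zero_outer[u' [v' hD]] h.
exists (fun q => if q == 0 then x else y), (fun q => if q == 0 then u else u'),
  (fun q => if q == 0 then v else v') => j k l.
by rewrite h sum2E /= hC hD !mulrA.
Qed.

Lemma polar_comb u v u' v' (C D : 'I_2 -> 'I_2 -> K) :
  polar (fun k l => u * C k l + v * D k l) (fun k l => u' * C k l + v' * D k l) =
  u * u' * polar C C + (u * v' + v * u') * polar C D + v * v' * polar D D.
Proof. by rewrite /polar; ring. Qed.

(** A nonzero discriminant gives the form [det (u B0 + v B1)] two distinct roots, hence two
    independent singular matrices whose span contains both slices. *)
Lemma hyperdet_neq0_rank3_le B : hyperdet B != 0 -> rank3_le 2 B.
Proof.
rewrite /hyperdet; set m := polar (B 0) (B 1); set p := polar (B 0) (B 0).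
set n := polar (B 1) (B 1) => h.
have [p0|p0] := eqVneq p 0.
  have m0 : m != 0.
    by apply: contraNneq h => ->; rewrite p0 expr0n mul0r subr0.
  (* As [p = 0], the slice [B 0] is one singular matrix; the other root of [v (2 m u + n v)] is
     [(n, - 2 m)]. *)
  pose D k l := n * B 0 k l + (- (2%:R * m)) * B 1 k l.
  have D0 : polar D D = 0 by rewrite polar_comb -/m -/n -/p p0; ring.
  apply: (rank3_le_pencil (x := vec2 1 (n / (2%:R * m)))
    (y := vec2 0 (- (2%:R * m)^-1)) p0 D0).
  by elim/ord2P => k l; rewrite !vec2E /D; field.
pose d := sqrtC (m ^+ 2 - p * n).
have dE : d ^+ 2 = m ^+ 2 - p * n by rewrite sqrtCK.
have d0 : d != 0 by rewrite sqrtC_eq0.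
(* The two roots with [v = 1], by the quadratic formula. *)
pose C s k l := (- m + s * d) / p * B 0 k l + 1 * B 1 k l.
have C0 s : s ^+ 2 = 1 -> polar (C s) (C s) = 0.
  move=> s1; rewrite polar_comb -/m -/n -/p.
  transitivity ((s ^+ 2 * d ^+ 2 - m ^+ 2 + p * n) / p); first by field.
  by rewrite s1 dE; ring.
apply: (rank3_le_pencil (x := vec2 (p / (2%:R * d)) (1 - (- m + d) / (2%:R * d)))
    (y := vec2 (- (p / (2%:R * d))) ((- m + d) / (2%:R * d)))
    (C0 1 _) (C0 (-1) _)); rewrite ?expr1n ?sqrrN ?expr1n //.
by elim/ord2P => k l; rewrite !vec2E /C; field; rewrite p0 d0.
Qed.

Definition w_tensor (j k l : 'I_2) : K := ((j + k + l)%N == 1%N)%:R.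

Lemma w_tensorE : (w_tensor 0 0 0 = 0) * (w_tensor 0 0 1 = 1) *
  (w_tensor 0 1 0 = 1) * (w_tensor 0 1 1 = 0) *
  (w_tensor 1 0 0 = 1) * (w_tensor 1 0 1 = 0) * (w_tensor 1 1 0 = 0) * (w_tensor 1 1 1 = 0).
Proof. by []. Qed.

Lemma basis_completion (y : 'rV[K]_2) : y != 0 ->
  exists z : 'rV[K]_2, y 0 0 * z 0 1 - z 0 0 * y 0 1 = 1.
Proof.
move=> y0; have [h|h] := eqVneq (y 0 0) 0; last first.
  by exists (vec2 0 (y 0 0)^-1); rewrite !vec2E mul0r subr0 mulfV.
have h1 : y 0 1 != 0.
  apply: contraNneq y0 => h1; apply/eqP/rowP.
  by elim/ord2P; rewrite mxE.
by exists (vec2 (- (y 0 1)^-1) 0); rewrite !vec2E mulr0 mulNr sub0r opprK mulVf.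
Qed.

(** The quadratic form is degenerate on the slices: [D] is taken in its radical and [C] is a
    complement. *)
Lemma hyperdet0_pencil B : hyperdet B = 0 -> exists (x y : 'rV[K]_2) (C D : 'I_2 -> 'I_2 -> K),
  [/\ x 0 0 * y 0 1 - y 0 0 * x 0 1 != 0, polar D D = 0, polar C D = 0 &
   forall j k l, B j k l = x 0 j * C k l + y 0 j * D k l].
Proof.
rewrite /hyperdet; set m := polar (B 0) (B 1); set p := polar (B 0) (B 0).
set n := polar (B 1) (B 1) => h.
have [n0|n0] := eqVneq n 0.
  exists (vec2 1 0), (vec2 0 1), (B 0), (B 1); split=> //.
  - by rewrite !vec2E mulr1 mulr0 subr0 oner_eq0.
  - by apply/eqP; rewrite -sqrf_eq0 -h n0 mulr0 subr0.
  - by elim/ord2P => k l; rewrite !vec2E; ring.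
(* For [n != 0], the vector [(n, - m)] lies in the radical, and [C] is the slice [B 1]. *)
exists (vec2 (m / n) 1), (vec2 n^-1 0), (fun k l => 0 * B 0 k l + 1 * B 1 k l),
  (fun k l => n * B 0 k l + (- m) * B 1 k l).
split.
- by rewrite !vec2E mulr0 mulr1 sub0r oppr_eq0 invr_eq0.
- by rewrite polar_comb -/m -/n -/p -[RHS](mulr0 (- n)) -h; ring.
- by rewrite polar_comb -/m -/n -/p; ring.
- by elim/ord2P => k l; rewrite !vec2E; field.
Qed.

Lemma rank3_le_matrix (x : 'rV[K]_2) (C : 'I_2 -> 'I_2 -> K) B :
  (forall j k l, B j k l = x 0 j * C k l) -> rank3_le 2 B.
Proof.
move=> BE.
pose C0 (k l : 'I_2) := (if k == 0 then 1 else 0) * C 0 l.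
pose C1 (k l : 'I_2) := (if k == 0 then 0 else 1) * C 1 l.
refine (rank3_le_pencil (x := x) (y := x) (C := C0) (D := C1) _ _ _).
- by rewrite /polar /C0 /=; ring.
- by rewrite /polar /C1 /=; ring.
- by move=> j k l; rewrite BE; elim/ord2P: k; rewrite /C0 /C1 /=; ring.
Qed.

(** With [D = y z], the relation [polar C D = 0] kills the [y' z'] coordinate of [C], and
    nonsingularity of [C] makes both mixed coordinates nonzero. Absorbing the [y z] coordinate into
    [w] leaves the three terms of [w_tensor]. *)
Lemma W_normal_form B : hyperdet B = 0 -> ~ rank3_le 2 B -> exists g1 g2 g3,
  [/\ g1 \in unitmx, g2 \in unitmx, g3 \in unitmx &
   B = act1 g1 (act2 g2 (act3 g3 w_tensor))].
Proof.
move=> /hyperdet0_pencil[x [w [C [D [xw D0 CD BE]]]]] nB.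
have [y [z hD]] := det_zero_outer (polar_eq0 D0).
have C0 : polar C C != 0.
  by apply: contra_notN nB => /eqP C0; apply: (rank3_le_pencil C0 D0 BE).
have y0 : y != 0.
  apply: contra_notN nB => /eqP y0; apply: (rank3_le_matrix (x := x) (C := C)).
  by move=> j k l; rewrite BE hD y0 mxE mul0r mulr0 addr0.
have z0 : z != 0.
  apply: contra_notN nB => /eqP z0; apply: (rank3_le_matrix (x := x) (C := C)).
  by move=> j k l; rewrite BE hD z0 mxE !mulr0 addr0.
have [y' yy] := basis_completion y0; have [z' zz] := basis_completion z0.
(* by Cramer's rule, the values of [co] at (y', z'), (y', z), (y, z'), (y, z) are, up to
   sign, the coordinates of [C] on y z, y z', y' z, y' z' *)
pose co (u v : 'rV[K]_2) := C 0 0 * u 0 1 * v 0 1 - C 0 1 * u 0 1 * v 0 0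
  - C 1 0 * u 0 0 * v 0 1 + C 1 1 * u 0 0 * v 0 0.
have CE k l : C k l = co y' z' * y 0 k * z 0 l - co y' z * y 0 k * z' 0 l
    - co y z' * y' 0 k * z 0 l + co y z * y' 0 k * z' 0 l.
  transitivity ((y 0 0 * y' 0 1 - y' 0 0 * y 0 1) *
    (z 0 0 * z' 0 1 - z' 0 0 * z 0 1) * C k l); first by rewrite yy zz !mul1r.
  by rewrite /co; elim/ord2P: k; elim/ord2P: l; ring.
have f0 : co y z = 0.
  by rewrite -[RHS]CD /polar !hD /co; ring.
have cd0 : co y' z * co y z' != 0.
  apply: contraNneq C0 => cd0; apply/eqP.
  transitivity (- 2%:R * (co y' z * co y z') *
    ((y 0 0 * y' 0 1 - y' 0 0 * y 0 1) * (z 0 0 * z' 0 1 - z' 0 0 * z 0 1))).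
    by rewrite /polar !CE f0; ring.
  by rewrite cd0; ring.
move: cd0; rewrite mulf_eq0 negb_or => /andP[c0 d0].
(* The columns are the images of [e0] and [e1]; the mixed coordinates of [C] are absorbed into [y']
   and [z']. *)
exists (mx2 (x 0 0) (w 0 0 + co y' z' * x 0 0) (x 0 1) (w 0 1 + co y' z' * x 0 1)),
  (mx2 (y 0 0) (- co y z' * y' 0 0) (y 0 1) (- co y z' * y' 0 1)),
  (mx2 (z 0 0) (- co y' z * z' 0 0) (z 0 1) (- co y' z * z' 0 1)).
rewrite !mx2_unit; split.
- by apply: contraNneq xw => <-; apply/eqP; ring.
- apply: contraNneq d0 => h; apply/eqP; rewrite -[LHS]mulr1 -yy -[RHS]oppr0 -h.
  by ring.
- apply: contraNneq c0 => h; apply/eqP; rewrite -[LHS]mulr1 -zz -[RHS]oppr0 -h.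
  by ring.
apply/funext => j; apply/funext => k; apply/funext => l.
rewrite BE hD CE f0 /act1 /act2 /act3 !sum2E !w_tensorE.
by elim/ord2P: j; elim/ord2P: k; elim/ord2P: l; rewrite !mx2E; ring.
Qed.

(** * Pencils of 2x2x2 tensors *)

Definition pencil T t : 'I_2 -> 'I_2 -> 'I_2 -> K :=
  fun j k l => T 0 j k l + t * T 1 j k l.

(** Both slices of [T] are linear combinations of the members at [t] and [u], each of which
    contributes two terms. *)
Lemma rank_le4_pencil T t u : t != u -> rank3_le 2 (pencil T t) -> rank3_le 2 (pencil T u) ->
  rank_le 4 T.
Proof.
move=> tu ht hu.
have ut : u - t != 0 by rewrite subr_eq0 eq_sym.
apply: (rank_leD
  (rank_le_vec_rank3_le (a := vec2 (u / (u - t)) (- (u - t)^-1)) ht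
    (fun=> fun=> fun=> fun=> erefl))
  (rank_le_vec_rank3_le (a := vec2 (- (t / (u - t))) ((u - t)^-1)) hu
    (fun=> fun=> fun=> fun=> erefl))).
by elim/ord2P => j k l; rewrite !vec2E /pencil; field.
Qed.

Lemma polar_pencil t (C C' D D' : 'I_2 -> 'I_2 -> K) :
  polar (fun k l => C k l + t * D k l) (fun k l => C' k l + t * D' k l) =
  polar C C' + t * (polar C D' + polar D C') + t ^+ 2 * polar D D'.
Proof. by rewrite /polar; ring. Qed.

(* [hyperdet (pencil T t)] has degree at most 4 in [t], so its fifth difference vanishes *)
Lemma hyperdet_pencil_eq0 T t : ~ rank_le 4 T -> hyperdet (pencil T t) = 0.
Proof.
move=> nT; apply/eqP/negP => /negP ht.
have h0 n : (0 < n)%N -> hyperdet (pencil T (t + n%:R)) = 0.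
  move=> n0; apply/eqP/negP => /negP hn; apply: nT.
  apply: (rank_le4_pencil _ (hyperdet_neq0_rank3_le ht) (hyperdet_neq0_rank3_le hn)).
  by rewrite eq_sym -subr_eq0 addrAC subrr add0r pnatr_eq0 -lt0n.
case/eqP: ht.
transitivity (5%:R * hyperdet (pencil T (t + 1%:R)) - 10%:R * hyperdet (pencil T (t + 2%:R))
  + 10%:R * hyperdet (pencil T (t + 3%:R)) - 5%:R * hyperdet (pencil T (t + 4%:R))
  + hyperdet (pencil T (t + 5%:R))).
  by rewrite /hyperdet /pencil !polar_pencil; ring.
by rewrite !h0 //; ring.
Qed.

Lemma hyperdet_slice_eq0 T : ~ rank_le 4 T -> hyperdet (T 0) = 0.
Proof.
move=> nT; rewrite -(hyperdet_pencil_eq0 0 nT); congr hyperdet.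
by apply/funext => j; apply/funext => k; apply/funext => l; rewrite /pencil mul0r addr0.
Qed.

(** * Vanishing hyperdeterminants when one slice is [w_tensor] *)

Section WSlice.
Variable T : tensor K 2 2 2 2.
Hypothesis T1 : T 1 = w_tensor.
Hypothesis nT : ~ rank_le 4 T.

Lemma Wslice_top : T 0 1 1 1 = 0.
Proof.
have f0 t := hyperdet_pencil_eq0 t nT.
(* The difference below isolates 12 times the cubic coefficient in [t], which is [4 * T 0 1 1 1]. *)
apply: (mulfI (_ : 48%:R != 0)); first by rewrite pnatr_eq0.
rewrite mulr0; transitivity (hyperdet (pencil T 2%:R) - 2%:R * hyperdet (pencil T 1)
  + 2%:R * hyperdet (pencil T (- 1)) - hyperdet (pencil T (- 2%:R))).
  by rewrite /hyperdet /pencil !polar_pencil T1 /polar !w_tensorE; ring.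
by rewrite !f0; ring.
Qed.

(** This is the quadratic coefficient in [t], doubled by the second difference; the quartic one is
    [hyperdet w_tensor = 0]. *)
Lemma Wslice_cone :
  (T 0 1 1 0 + T 0 1 0 1 - T 0 0 1 1) ^+ 2 = 4%:R * T 0 1 1 0 * T 0 1 0 1.
Proof.
have f0 t := hyperdet_pencil_eq0 t nT.
apply/eqP; rewrite -subr_eq0; apply/eqP.
apply: (mulfI (_ : 2%:R != 0)); first by rewrite pnatr_eq0.
rewrite mulr0; transitivity (hyperdet (pencil T 1) + hyperdet (pencil T (- 1))
  - 2%:R * hyperdet (pencil T 0)).
  by rewrite /hyperdet /pencil !polar_pencil T1 /polar !w_tensorE Wslice_top; ring.
by rewrite !f0; ring.
Qed.

(** These are the hyperdeterminants of the slices at index 0 along the second, fourth and third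
    factors. *)
Lemma Wslice_swap :
  [/\ (T 0 0 0 1 - T 0 0 1 0) ^+ 2 = - 4%:R * T 0 0 0 0 * T 0 0 1 1,
      (T 0 0 1 0 - T 0 1 0 0) ^+ 2 = - 4%:R * T 0 0 0 0 * T 0 1 1 0 &
      (T 0 1 0 0 - T 0 0 0 1) ^+ 2 = - 4%:R * T 0 0 0 0 * T 0 1 0 1].
Proof.
have n1 : ~ rank_le 4 (fun i j k l => T j i k l).
  by move=> h; apply: nT; exact: (rank_le_swap12 h).
have n2 : ~ rank_le 4 (fun i j k l => T j k i l).
  by move=> h; apply: nT; exact: (rank_le_swap23 (rank_le_swap12 h)).
have n3 : ~ rank_le 4 (fun i j k l => T j k l i).
  by move=> h; apply: nT; exact: (rank_le_swap34 (rank_le_swap23 (rank_le_swap12 h))).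
split; apply/eqP; rewrite -subr_eq0; apply/eqP.
- by rewrite -[RHS](hyperdet_slice_eq0 n1) /hyperdet /polar /= T1 !w_tensorE; ring.
- by rewrite -[RHS](hyperdet_slice_eq0 n3) /hyperdet /polar /= T1 !w_tensorE; ring.
- by rewrite -[RHS](hyperdet_slice_eq0 n2) /hyperdet /polar /= T1 !w_tensorE; ring.
Qed.

End WSlice.

(** * Tensors supported on the indices of weight 2 *)

Definition weight2_tensor (p q r : K) (j k l : 'I_2) : K :=
  if (j + k + l)%N == 2%N then
    if l == 0 then p else if k == 0 then q else r
  else 0.

Lemma weight2_tensorE p q r :
  (weight2_tensor p q r 0 0 0 = 0) * (weight2_tensor p q r 0 0 1 = 0) *
  (weight2_tensor p q r 0 1 0 = 0) * (weight2_tensor p q r 0 1 1 = r) *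
  (weight2_tensor p q r 1 0 0 = 0) * (weight2_tensor p q r 1 0 1 = q) *
  (weight2_tensor p q r 1 1 0 = p) * (weight2_tensor p q r 1 1 1 = 0).
Proof. by []. Qed.

(** Nonzero entries occur only at indices with two zeros and two ones. *)
Definition balanced p q r : tensor K 2 2 2 2 :=
  fun i => if i == 0 then weight2_tensor p q r else w_tensor.

Lemma balancedE p q r :
  (balanced p q r 0 = weight2_tensor p q r) * (balanced p q r 1 = w_tensor).
Proof. by []. Qed.

Lemma cube_root_of_unity : exists w : K, 1 + w + w ^+ 2 = 0.
Proof.
exists ((-1 + sqrtC (- 3%:R)) / 2%:R).
transitivity ((3%:R + sqrtC (- 3%:R) ^+ 2) / 4%:R : K); first by field.
by rewrite sqrtCK subrr mul0r.
Qed.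

(** For [p != 0], three terms give [balanced p p p] and the fourth corrects one entry to [r]. For
    [p = 0], [w_tensor] takes three terms and the entry [r] the fourth. *)
Lemma rank_le4_balanced_eq p r : rank_le 4 (balanced p p r).
Proof.
have [->|p0] := eqVneq p 0.
  pose e0 := vec2 (1 : K) 0; pose e1 := vec2 (0 : K) 1.
  apply: (rank_leD (rank_leD (rank_leD (rank_le_outer e1 e0 e0 e1) (rank_le_outer e1 e0 e1 e0)
    (fun _ _ _ _ => erefl)) (rank_le_outer e1 e1 e0 e0) (fun _ _ _ _ => erefl))
    (rank_le_outer (vec2 r 0) e0 e1 e1)).
  by apply: tensor2P; rewrite balancedE ?w_tensorE ?weight2_tensorE /outer !vec2E; ring.
(* In [sum_u term u] over the cube roots of unity [u], an entry of index weight [n]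
   carries [sum_u u ^+ (n + 1)], which vanishes unless [n = 2]. *)
have [w w1] := cube_root_of_unity.
pose t := sqrtC p.
have tE : t ^+ 2 = p by rewrite sqrtCK.
have t0 : t != 0 by rewrite sqrtC_eq0.
pose term u := outer (vec2 (u / 3%:R) (u ^+ 2 / (3%:R * t)))
  (vec2 1 (t * u)) (vec2 1 (t * u)) (vec2 1 (t * u)).
apply: (rank_leD (rank_leD (rank_leD (rank_le_outer _ _ _ _ : rank_le 1 (term 1))
    (rank_le_outer _ _ _ _ : rank_le 1 (term w)) (fun _ _ _ _ => erefl))
    (rank_le_outer _ _ _ _ : rank_le 1 (term (w ^+ 2))) (fun _ _ _ _ => erefl))
    (rank_le_outer (vec2 (r - p) 0) (vec2 1 0) (vec2 0 1) (vec2 0 1))).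
have S1 : 1 + w + w ^+ 2 = 0 by [].
have S2 : 1 + w ^+ 2 + w ^+ 4 = 0 by rewrite -[RHS](mulr0 (1 - w + w ^+ 2)) -w1; ring.
have S4 : 1 + w ^+ 4 + w ^+ 8 = 0.
  by rewrite -[RHS](mulr0 ((1 - w + w ^+ 2) * (1 - w ^+ 2 + w ^+ 4))) -w1; ring.
have w3 : w ^+ 3 = 1.
  by apply/eqP; rewrite -subr_eq0 -[0](mulr0 (w - 1)) -w1; apply/eqP; ring.
have S5 : 1 + w ^+ 5 + w ^+ 10 = 0.
  by rewrite -[RHS]w1 (exprD w 3 2) (exprD w 9 1) (exprM w 3 3) w3; ring.
have S3 : 1 + w ^+ 3 + w ^+ 6 = 3%:R by rewrite (exprM w 3 2) w3; ring.
apply: tensor2P; rewrite balancedE ?w_tensorE ?weight2_tensorE /term /outer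
  !vec2E -?tE; apply/esym.
- by transitivity ((1 + w + w ^+ 2) / 3%:R); [field | rewrite S1 mul0r].
- by transitivity ((1 + w ^+ 2 + w ^+ 4) * t / 3%:R); [field | rewrite S2 !mul0r].
- by transitivity ((1 + w ^+ 2 + w ^+ 4) * t / 3%:R); [field | rewrite S2 !mul0r].
- transitivity ((1 + w ^+ 3 + w ^+ 6) * t ^+ 2 / 3%:R + (r - t ^+ 2)); first by field.
  by rewrite S3; field.
- by transitivity ((1 + w ^+ 2 + w ^+ 4) * t / 3%:R); [field | rewrite S2 !mul0r].
- by transitivity ((1 + w ^+ 3 + w ^+ 6) * t ^+ 2 / 3%:R); [field | rewrite S3; field].
- by transitivity ((1 + w ^+ 3 + w ^+ 6) * t ^+ 2 / 3%:R); [field | rewrite S3; field].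
- by transitivity ((1 + w ^+ 4 + w ^+ 8) * t ^+ 3 / 3%:R); [field | rewrite S4 !mul0r].
- by transitivity ((1 + w ^+ 2 + w ^+ 4) / (3%:R * t)); [field | rewrite S2 !mul0r].
- by transitivity ((1 + w ^+ 3 + w ^+ 6) / 3%:R); [field | rewrite S3; field].
- by transitivity ((1 + w ^+ 3 + w ^+ 6) / 3%:R); [field | rewrite S3; field].
- by transitivity ((1 + w ^+ 4 + w ^+ 8) * t / 3%:R); [field | rewrite S4 !mul0r].
- by transitivity ((1 + w ^+ 3 + w ^+ 6) / 3%:R); [field | rewrite S3; field].
- by transitivity ((1 + w ^+ 4 + w ^+ 8) * t / 3%:R); [field | rewrite S4 !mul0r].
- by transitivity ((1 + w ^+ 4 + w ^+ 8) * t / 3%:R); [field | rewrite S4 !mul0r].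
- by transitivity ((1 + w ^+ 5 + w ^+ 10) * t ^+ 2 / 3%:R); [field | rewrite S5 !mul0r].
Qed.

Definition cross_mx (a0 a1 b0 b1 : K) (i j : 'I_2) : K :=
  if i == 0 then (if j == 0 then a0 else b0) else (if j == 0 then b1 else a1).

Lemma cross_mxE a0 a1 b0 b1 :
  (cross_mx a0 a1 b0 b1 0 0 = a0) * (cross_mx a0 a1 b0 b1 0 1 = b0) *
  (cross_mx a0 a1 b0 b1 1 0 = b1) * (cross_mx a0 a1 b0 b1 1 1 = a1).
Proof. by []. Qed.

(** In [(A + B) (A' + B') + (A - B) (A' - B')] the mixed terms cancel; the hypotheses say that all
    four matrices are singular. *)
Lemma rank_le_cross_mx a0 a1 b0 b1 c0 c1 d0 d1 : a0 * a1 = b0 * b1 -> c0 * c1 = d0 * d1 ->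
  rank_le 2 (fun i j k l => (cross_mx a0 a1 b0 b1 i j * cross_mx c0 c1 d0 d1 k l +
  cross_mx a0 a1 (- b0) (- b1) i j * cross_mx c0 c1 (- d0) (- d1) k l) / 2%:R).
Proof.
move=> hab hcd.
have h1 : rank_le 1 (fun i j k l =>
    cross_mx a0 a1 b0 b1 i j * (cross_mx c0 c1 d0 d1 k l / 2%:R)).
  apply: (rank_le_prod_mx (P := cross_mx a0 a1 b0 b1)
    (N := fun k l => cross_mx c0 c1 d0 d1 k l / 2%:R)) => //.
  by rewrite !cross_mxE mulrACA hcd mulrACA.
have h2 : rank_le 1 (fun i j k l =>
    cross_mx a0 a1 (- b0) (- b1) i j * (cross_mx c0 c1 (- d0) (- d1) k l / 2%:R)).
  apply: (rank_le_prod_mx (P := cross_mx a0 a1 (- b0) (- b1))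
    (N := fun k l => cross_mx c0 c1 (- d0) (- d1) k l / 2%:R)) => //.
    by rewrite !cross_mxE mulrNN.
  by rewrite !cross_mxE mulrACA hcd -[d0 * d1]mulrNN mulrACA.
by apply: (rank_leD h1 h2) => i j k l; rewrite mulrDl !mulrA.
Qed.

Lemma rank_le4_balanced_generic p q r : p != q -> p != 0 -> q != 0 -> r != 0 ->
  rank_le 4 (balanced p q r).
Proof.
move=> pq p0 q0 r0.
(* The four terms are [(A + s B) * (A' + s B') / 2], [s = 1, -1], for two quadruples of a
   diagonal [A], [A'] and an antidiagonal [B], [B']. The [A A'] and the [B B'] sum to the
   two blocks of the flattening; with [b ^+ 2 = X], singularity of all four pairs of
   matrices amounts to the quartic equation below for [X]. *)
have [X hX] : exists X, r * (X ^+ 2 - p * q) ^+ 2 = 4%:R * p * q * X * (X - p) * (X - q).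
  (* Lower coefficients of the quartic after division by [r], solved for [X ^+ 4]. *)
  have [X] := @solve_monicpoly K 4 (nth 0 [:: - (p * q) ^+ 2; 4%:R * (p * q) ^+ 2 / r;
    2%:R * p * q - 4%:R * p * q * (p + q) / r; 4%:R * p * q / r]) isT.
  rewrite !big_ord_recl big_ord0 /= /bump /= => h; exists X.
  transitivity (r * X ^+ 4 + r * ((p * q) ^+ 2 - 2%:R * p * q * X ^+ 2)); first by ring.
  by rewrite h; field.
have X0 : X != 0.
  apply/eqP => h; move/eqP: hX; rewrite h expr0n sub0r sqrrN mulr0 !mul0r.
  by rewrite mulf_eq0 (negbTE r0) sqrf_eq0 mulf_eq0 (negbTE p0) (negbTE q0).
(* Otherwise the quartic gives [X = p] or [X = q], hence [p = q]. This keeps [b ^+ 2 + e ^+ 2]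
   nonzero below. *)
have Xpq : X ^+ 2 - p * q != 0.
  apply/eqP => h; move: hX; rewrite h expr0n mulr0 => /esym/eqP.
  rewrite !mulf_eq0 pnatr_eq0 (negbTE p0) (negbTE q0) (negbTE X0) /= !subr_eq0.
  move: h => /eqP; rewrite subr_eq0 => /eqP h /orP[]/eqP hp.
    move: h; rewrite hp expr2 => /(mulfI p0) /eqP; exact/negP.
  by move: h; rewrite hp expr2 => /(mulIf q0) /eqP; rewrite eq_sym; exact/negP.
(* The choice [b ^+ 2 * e ^+ 2 = - (p * q)] turns the singularity conditions on the second matrices
   of both quadruples into the same equation [hr]. *)
pose b := sqrtC X; pose e := sqrtC (- (p * q / X)).
have bE : b ^+ 2 = X by rewrite sqrtCK.
have eE : e ^+ 2 = - (p * q / X) by rewrite sqrtCK.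
have b0 : b != 0 by rewrite sqrtC_eq0.
have e0 : e != 0 by rewrite sqrtC_eq0 oppr_eq0 !mulf_neq0 ?invr_eq0.
have hpq : p * q = - (b ^+ 2 * e ^+ 2) by rewrite bE eE; field.
have be0 : b ^+ 2 + e ^+ 2 != 0.
  apply: contraNneq Xpq => h; rewrite -bE hpq; apply/eqP.
  by rewrite -[RHS](mulr0 (b ^+ 2)) -h; ring.
have hr : r * (b ^+ 2 + e ^+ 2) ^+ 2 =
    - 4%:R * e ^+ 2 * b ^+ 2 * (b ^+ 2 - (p + q) - e ^+ 2).
  apply: (mulfI (_ : b ^+ 4 != 0)); first by rewrite expf_neq0.
  transitivity (r * (X ^+ 2 - p * q) ^+ 2); first by rewrite -bE hpq; ring.
  rewrite hX; transitivity (4%:R * (p * q) * X * (X ^+ 2 - (p + q) * X + p * q)).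
    by ring.
  by rewrite -bE hpq; ring.
(* Determinant of the system [b x + e y = q], [x / b - y / e = 1] for the antidiagonal entries of
   the two blocks (with [p] for [q] in the other pair); Cramer's rule gives the entries used in [h1]
   and [h2]. *)
pose dl := - (b ^+ 2 + e ^+ 2) / (b * e).
have dl0 : dl != 0 by rewrite mulf_neq0 ?oppr_eq0 ?invr_eq0 ?mulf_neq0.
have h1 : rank_le 2 (fun i j k l => (cross_mx 1 1 b b^-1 i j *
    cross_mx 2^-1 (r / 2%:R) ((- q / e - e) / dl) ((- p / e - e) / dl) k l +
  cross_mx 1 1 (- b) (- b^-1) i j *
    cross_mx 2^-1 (r / 2%:R) (- ((- q / e - e) / dl)) (- ((- p / e - e) / dl)) k l) / 2%:R).
  apply: rank_le_cross_mx; first by rewrite mulfV // mulr1.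
  transitivity (r * (b ^+ 2 + e ^+ 2) ^+ 2 / (4%:R * (b * e) ^+ 2 * dl ^+ 2)).
    by rewrite /dl; field; rewrite -?opprD ?oppr_eq0 ?be0 b0 e0.
  rewrite hr; transitivity ((p * q + (p + q) * e ^+ 2 + e ^+ 4) / (e ^+ 2 * dl ^+ 2)).
    by rewrite hpq; field; rewrite dl0 b0 e0.
  by field; rewrite dl0 e0.
have h2 : rank_le 2 (fun i j k l => (cross_mx 1 (-1) e (- e^-1) i j *
    cross_mx (- 2^-1) (r / 2%:R) ((b - q / b) / dl) ((b - p / b) / dl) k l +
  cross_mx 1 (-1) (- e) (- - e^-1) i j *
    cross_mx (- 2^-1) (r / 2%:R) (- ((b - q / b) / dl)) (- ((b - p / b) / dl)) k l) / 2%:R).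
  apply: rank_le_cross_mx; first by rewrite !mulrN mulfV // mulr1.
  transitivity (- (r * (b ^+ 2 + e ^+ 2) ^+ 2) / (4%:R * (b * e) ^+ 2 * dl ^+ 2)).
    by rewrite /dl; field; rewrite -?opprD ?oppr_eq0 ?be0 b0 e0.
  rewrite hr; transitivity ((p * q - (p + q) * b ^+ 2 + b ^+ 4) / (b ^+ 2 * dl ^+ 2)).
    by rewrite hpq; field; rewrite dl0 b0 e0.
  by field; rewrite dl0 b0.
apply: (rank_leD h1 h2); apply: tensor2P; rewrite balancedE ?w_tensorE ?weight2_tensorE
  !cross_mxE /dl; field;
  by rewrite -?opprD ?oppr_eq0 ?be0 ?b0 ?e0.
Qed.

(** If two parameters agree, a permutation of the factors leads to [rank_le4_balanced_eq]. Otherwise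
    all are nonzero, because on this cone a vanishing parameter makes the other two equal. *)
Lemma rank_le4_balanced p q r : (p + q - r) ^+ 2 = 4%:R * p * q -> rank_le 4 (balanced p q r).
Proof.
move=> h.
have [->|pq] := eqVneq p q; first exact: rank_le4_balanced_eq.
have [->|qr] := eqVneq q r.
  apply: (rank_le_ext (rank_le_swap34 (rank_le_swap23 (rank_le4_balanced_eq r p)))).
  by apply: tensor2P.
have [->|pr] := eqVneq p r.
  apply: (rank_le_ext (rank_le_swap23 (rank_le4_balanced_eq r q))).
  by apply: tensor2P.
have sqr0 (x y : K) : (x - y) ^+ 2 = 0 -> x == y.
  by move/eqP; rewrite sqrf_eq0 subr_eq0.
apply: rank_le4_balanced_generic => //.
- by apply: contraNneq qr => p0; apply: sqr0; move: h; rewrite p0 add0r => ->; ring.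
- by apply: contraNneq pr => q0; apply: sqr0; move: h; rewrite q0 addr0 => ->; ring.
- apply: contraNneq pq => r0; apply: sqr0; move: h; rewrite r0 subr0 => h.
  by transitivity ((p + q) ^+ 2 - 4%:R * p * q); [ring | rewrite h subrr].
Qed.

(** * Tensors with a slice [w_tensor], and the upper bound *)

Lemma sqrB_eq0 (x y c : K) : (x - y) ^+ 2 = c -> c = 0 -> x = y.
Proof. by move=> <- /eqP; rewrite sqrf_eq0 subr_eq0 => /eqP. Qed.

(** A zero corner forces the three entries of weight 1 in [T 0] to coincide, so subtracting a
    multiple of [w_tensor] from [T 0] leaves a balanced tensor. *)
Lemma rank_le4_Wslice_corner0 T : T 1 = w_tensor -> T 0 0 0 0 = 0 -> rank_le 4 T.
Proof.
move=> T1 a0; apply: contrapT => nT; apply: (nT).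
have [] := Wslice_swap T1 nT; rewrite a0 mulr0 !mul0r.
move=> /sqrB_eq0/(_ erefl) xy /sqrB_eq0/(_ erefl) yz _.
apply: (rank_le_ext (rank_le_shear1 (T 0 0 0 1) (rank_le4_balanced (Wslice_cone T1 nT)))).
apply: tensor2P; rewrite !balancedE ?T1 ?w_tensorE ?weight2_tensorE /=
  ?(Wslice_top T1 nT) ?a0 -?yz -?xy;
  by rewrite ?mulr0 ?mulr1 ?addr0 ?add0r.
Qed.

(** Opposite shears in the second and fourth factors fix [w_tensor] and change the corner into
    [T 0 0 0 0 + b s - q s ^+ 2], which vanishes for a suitable [s] since [q != 0]. *)
Lemma rank_le4_Wslice_shear T : T 1 = w_tensor -> T 0 1 0 1 != 0 -> rank_le 4 T.
Proof.
move=> T1; set q := T 0 1 0 1 => q0.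
pose b := T 0 1 0 0 - T 0 0 0 1.
pose s := (b + sqrtC (b ^+ 2 + 4%:R * q * T 0 0 0 0)) / (2%:R * q).
have hs : q * s ^+ 2 = b * s + T 0 0 0 0.
  apply: (mulfI (_ : 4%:R * q != 0)); first by rewrite mulf_neq0 ?pnatr_eq0.
  transitivity ((2%:R * q * s - b) ^+ 2 + 4%:R * q * b * s - b ^+ 2); first by ring.
  rewrite [2%:R * q * s]mulrC divfK ?mulf_neq0 ?pnatr_eq0 // [b + _]addrC addrK sqrtCK.
  by ring.
have u1 (t : K) : mx2 1 t 0 1 \in unitmx by rewrite mx2_unit mulr1 mulr0 subr0 oner_eq0.
apply: (rank_le_act3_inv (u1 (- s))); apply: (rank_le_act1_inv (u1 s)).
apply: rank_le4_Wslice_corner0.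
  apply/funext => j; apply/funext => k; apply/funext => l.
  rewrite /act1 /act3 !sum2E T1.
  by elim/ord2P: j; elim/ord2P: k; elim/ord2P: l; rewrite !mx2E ?w_tensorE; ring.
rewrite /act1 /act3 !sum2E !mx2E.
transitivity (b * s + T 0 0 0 0 - q * s ^+ 2); first by rewrite /b /q; ring.
by rewrite hs subrr.
Qed.

(** The symmetry of [w_tensor] brings any nonzero entry of weight 2 in [T 0] to the position
    [0 1 0 1]. If all three vanish, subtracting a multiple of [w_tensor] from [T 0] leaves only its
    corner: three terms plus one. *)
Lemma rank_le4_Wslice T : T 1 = w_tensor -> rank_le 4 T.
Proof.
move=> T1; apply: contrapT => nT; apply: (nT).
have [q0|/(rank_le4_Wslice_shear T1)//] := eqVneq (T 0 1 0 1) 0.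
have [p0|p0] := eqVneq (T 0 1 1 0) 0; last first.
  apply: (rank_le_swap34 (T := fun i j k l => T i j l k)); apply: rank_le4_Wslice_shear => //.
  apply/funext => j; apply/funext => k; apply/funext => l.
  by rewrite T1; elim/ord2P: j; elim/ord2P: k; elim/ord2P: l.
have [r0|r0] := eqVneq (T 0 0 1 1) 0; last first.
  apply: (rank_le_swap23 (T := fun i j k l => T i k j l)); apply: rank_le4_Wslice_shear => //.
  apply/funext => j; apply/funext => k; apply/funext => l.
  by rewrite T1; elim/ord2P: j; elim/ord2P: k; elim/ord2P: l.
have [] := Wslice_swap T1 nT; rewrite p0 q0 r0 !mulr0.
move=> /sqrB_eq0/(_ erefl) xy /sqrB_eq0/(_ erefl) yz _.
pose e0 := vec2 (1 : K) 0; pose e1 := vec2 (0 : K) 1.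
have h := rank_leD (rank_leD (rank_leD (rank_le_outer e1 e0 e0 e1) (rank_le_outer e1 e0 e1 e0)
    (fun _ _ _ _ => erefl)) (rank_le_outer e1 e1 e0 e0) (fun _ _ _ _ => erefl))
    (rank_le_outer (vec2 (T 0 0 0 0) 0) e0 e0 e0) (fun _ _ _ _ => erefl).
apply: (rank_le_ext (rank_le_shear1 (T 0 0 0 1) h)).
by apply: tensor2P; rewrite ?T1 ?w_tensorE /= ?(Wslice_top T1 nT) ?q0 ?p0 ?r0 -?yz -?xy
  /outer !vec2E; ring.
Qed.

Lemma rank_le4_slice T : ~ rank3_le 2 (T 1) -> rank_le 4 T.
Proof.
move=> n1; have h0 : hyperdet (T 1) = 0.
  by apply/eqP/negPn/negP => /hyperdet_neq0_rank3_le.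
have [g1 [g2 [g3 [u1 u2 u3 E]]]] := W_normal_form h0 n1.
apply: (rank_le_act1_inv (g := invmx g1)); first by rewrite unitmx_inv.
apply: (rank_le_act2_inv (g := invmx g2)); first by rewrite unitmx_inv.
apply: (rank_le_act3_inv (g := invmx g3)); first by rewrite unitmx_inv.
apply: rank_le4_Wslice; rewrite E.
by rewrite act1VK // act2VK // act3VK.
Qed.

Lemma rank_le4 T : rank_le 4 T.
Proof.
have [h1|/rank_le4_slice//] := pselect (rank3_le 2 (T 1)).
have [h0|h0] := pselect (rank3_le 2 (T 0)); last exact: rank_le_flip1 (rank_le4_slice _).
apply: (rank_leD (rank_le_vec_rank3_le (a := vec2 1 0) h0 (fun _ _ _ _ => erefl))
            (rank_le_vec_rank3_le (a := vec2 0 1) h1 (fun _ _ _ _ => erefl))).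
by elim/ord2P => j k l; rewrite !vec2E mul1r mul0r ?addr0 ?add0r.
Qed.

End RankAtMostFour.

(** * Lower bound: the 4x4 flattening *)

Section Flattening.
Local Open Scope ring_scope.
Variable K : fieldType.
Implicit Types (T U : tensor K 2 2 2 2).

Lemma sum_of_rank_one_rank_le s T : sum_of_rank_one T s -> rank_le s T.
Proof.
move=> [X [X1 hT]]; pose v (q : 'I_s) (w : 'rV[K]_2 * 'rV[K]_2 * 'rV[K]_2 * 'rV[K]_2) :=
  X q = outer w.1.1.1 w.1.1.2 w.1.2 w.2.
have /choice[f hf] : forall q, exists w, v q w.
  by move=> q; have [a [b [c [d [_ Xq]]]]] := X1 q; exists (a, b, c, d); rewrite /v Xq.
exists (fun q => (f q).1.1.1), (fun q => (f q).1.1.2), (fun q => (f q).1.2),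
  (fun q => (f q).2) => i j k l.
by rewrite hT; apply: eq_bigr => q _; rewrite hf.
Qed.

(** Terms with a zero factor vanish and are dropped, whence [t <= s]. *)
Lemma rank_le_sum_of_rank_one s T : rank_le s T -> exists2 t, (t <= s)%N & sum_of_rank_one T t.
Proof.
elim: s T => [|s IHs] T [a [b [c [d hT]]]].
  exists 0%N => //; exists (fun=> T); split; first by case.
  by move=> i j k l; rewrite hT !big_ord0.
pose U := fun i j k l => \sum_(q < s) outer (a (lift ord0 q)) (b (lift ord0 q))
  (c (lift ord0 q)) (d (lift ord0 q)) i j k l.
have TU i j k l : T i j k l = outer (a ord0) (b ord0) (c ord0) (d ord0) i j k l
    + U i j k l by rewrite hT big_ord_recl.
have [|t ts [X [X1 hU]]] := IHs U.
  by exists (a \o lift ord0), (b \o lift ord0), (c \o lift ord0), (d \o lift ord0).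
have [/and4P[a0 b0 c0 d0]|h0] :=
  boolP [&& a ord0 != 0, b ord0 != 0, c ord0 != 0 & d ord0 != 0].
  exists t.+1 => //.
  exists (fun q => if unlift ord0 q is Some q' then X q'
                   else outer (a ord0) (b ord0) (c ord0) (d ord0)); split.
    move=> q; case: (unlift ord0 q) => [q'|]; first exact: X1.
    by exists (a ord0), (b ord0), (c ord0), (d ord0).
  move=> i j k l; rewrite TU big_ord_recl unlift_none hU; congr (_ + _).
  by apply: eq_bigr => q _; rewrite liftK.
exists t; first exact: leqW.
exists X; split=> // i j k l; rewrite TU -hU [X in X + _](_ : _ = 0) ?add0r //.
move: h0; rewrite !negb_and !negbK /outer.
by case/or4P => /eqP ->; rewrite mxE ?(mul0r, mulr0).
Qed.

Lemma trank_le s T : rank_le s T -> (trank T <= s)%N.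
Proof.
move=> /rank_le_sum_of_rank_one[t ts Tt]; rewrite /trank; case: ex_minnP => m _ min.
by apply: leq_trans ts; apply: min; apply/asboolP.
Qed.

Lemma rank_le_trank T : rank_le (trank T) T.
Proof.
by rewrite /trank; case: ex_minnP => m /asboolP/sum_of_rank_one_rank_le.
Qed.

(** The binary digits identify ['I_4] with pairs of indices. *)
Definition ord4_hi (r : 'I_4) : 'I_2 := inord (r %/ 2).
Definition ord4_lo (r : 'I_4) : 'I_2 := inord (r %% 2).

Lemma hi_lo_eq r c : (ord4_hi r == ord4_hi c) && (ord4_lo r == ord4_lo c) = (r == c).
Proof.
apply/andP/eqP => [[/eqP h /eqP l]|-> //]; apply: val_inj.
have hiE (x : 'I_4) : val (ord4_hi x) = (x %/ 2)%N by rewrite /= inordK // ltn_divLR.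
have loE (x : 'I_4) : val (ord4_lo x) = (x %% 2)%N by rewrite /= inordK // ltn_mod.
by rewrite /= (divn_eq r 2) (divn_eq c 2) -!hiE -!loE h l.
Qed.

Definition flattening T : 'M[K]_4 :=
  \matrix_(r, c) T (ord4_hi r) (ord4_lo r) (ord4_hi c) (ord4_lo c).

(** The flattening factors as a 4 by [s] matrix times an [s] by 4 matrix. *)
Lemma rank_flattening s T : rank_le s T -> (\rank (flattening T) <= s)%N.
Proof.
move=> [a [b [c [d hT]]]].
have -> : flattening T = (\matrix_(r < 4, q < s) (a q 0 (ord4_hi r) * b q 0 (ord4_lo r))) *m
    (\matrix_(q < s, x < 4) (c q 0 (ord4_hi x) * d q 0 (ord4_lo x))).
  apply/matrixP => r x; rewrite !mxE hT; apply: eq_bigr => q _.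
  by rewrite !mxE /outer !mulrA.
exact: mulmx_max_rank.
Qed.

Lemma trank_ge4 T : \det (flattening T) != 0 -> (4 <= trank T)%N.
Proof.
rewrite -unitfE -unitmxE => /mxrank_unit rT.
by rewrite -[4%N in X in (X <= _)%N]rT rank_flattening //; exact: rank_le_trank.
Qed.

(** The tensor whose flattening is the identity matrix. *)
Definition id_tensor : tensor K 2 2 2 2 := fun i j k l => ((i == k) && (j == l))%:R.

Lemma flattening_line T t :
  flattening (fun i j k l => T i j k l + t * id_tensor i j k l) = t%:M - (- flattening T).
Proof.
by apply/matrixP => r c; rewrite !mxE /id_tensor hi_lo_eq opprK addrC mulr_natr.
Qed.

(** A singular flattening makes [t] an eigenvalue of [- flattening T], and the characteristic
    polynomial has at most four roots. *)
Lemma det_flattening_line T (rs : seq K) : uniq rs -> (4 < size rs)%N ->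
  exists2 t, t \in rs &
    \det (flattening (fun i j k l => T i j k l + t * id_tensor i j k l)) != 0.
Proof.
move=> urs srs; apply/hasP/negPn/negP => /hasPn h0.
have p0 : char_poly (- flattening T) != 0 by apply: monic_neq0; exact: char_poly_monic.
have ra : all (root (char_poly (- flattening T))) rs.
  apply/allP => t /h0; rewrite negbK flattening_line => /eqP dt.
  rewrite -eigenvalue_root_char; apply/eigenvalueP.
  have /eqP/det0P[v v0 hv] : \det (- flattening T - t%:M) = 0.
    by rewrite -opprB -scaleN1r detZ dt mulr0.
  exists v => //; apply/eqP; rewrite -subr_eq0 -hv mulmxBr mul_mx_scalar //.
by have := max_poly_roots p0 ra urs; rewrite size_char_poly ltnNge => /negP.
Qed.

End Flattening.

(** * Openness and density of the nonsingular flattenings *)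

Section Topology.
Local Open Scope ring_scope.
Variable K : numFieldType.
Local Notation tens := (tensor K^o 2 2 2 2).
Local Open Scope classical_set_scope.

(** The product topology is the supremum of the topologies pulled back along the evaluations, so
    each evaluation is tested separately. *)
Lemma cvg_arrow (X I : Type) (V : topologicalType) (F : set_system X)
    (f : X -> I -> V) (g : I -> V) : Filter F ->
  (forall i, f x i @[x --> F] --> g i) -> f x @[x --> F] --> g.
Proof.
move=> FF h; apply/cvg_sup => i U [V0 [[W oW <-] Wg WU]].
apply: (filterS WU); apply: (h i); exact: open_nbhs_nbhs.
Qed.

Lemma continuous_coord i j k l : continuous (fun T : tens => T i j k l : K^o).
Proof.
move=> T.
have h1 : T' i @[T' --> T] --> T i by exact: (@proj_continuous _ _ i T).
have h2 : T' i j @[T' --> T] --> T i j.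
  exact: (cvg_comp _ _ h1 (@proj_continuous _ _ j (T i))).
have h3 : T' i j k @[T' --> T] --> T i j k.
  exact: (cvg_comp _ _ h2 (@proj_continuous _ _ k (T i j))).
exact: (cvg_comp _ _ h3 (@proj_continuous _ _ l (T i j k))).
Qed.

(** By the Leibniz formula, the determinant is a polynomial in the coordinates. *)
Lemma continuous_det_flattening : continuous (fun T : tens => \det (flattening T) : K^o).
Proof.
have cM : continuous (fun z : K^o * K^o => z.1 * z.2 : K^o).
  by move=> z; apply: cvgM; [exact: cvg_fst | exact: cvg_snd].
have cF r c : continuous (fun T : tens => flattening T r c : K^o).
  rewrite (_ : (fun T : tens => _) =
    (fun T : tens => T (ord4_hi r) (ord4_lo r) (ord4_hi c) (ord4_lo c))).
    exact: continuous_coord.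
  by apply/funext => T; rewrite mxE.
have cP (f : 'I_4 -> 'I_4) : continuous (fun T : tens => \prod_r flattening T r (f r) : K^o).
  by apply: (continuous_big (op := *%R : K^o -> K^o -> K^o) cM) => r _; exact: cF.
apply: (continuous_big (op := +%R : K^o -> K^o -> K^o)) => [|s _ T].
  exact: add_continuous.
exact: (cvgM (cvg_cst _) (cP _ T)).
Qed.

Lemma open_det_flattening : open [set T : tens | \det (flattening T) != 0].
Proof.
rewrite openE => T /= dT; rewrite /interior /=.
by move/cvgr_neq0: (@continuous_det_flattening T); apply.
Qed.

Lemma line_cvg (T : tens) :
  (fun i j k l => T i j k l + t * id_tensor K i j k l : K^o) @[t --> (0 : K^o)] --> T.
Proof.
apply: cvg_arrow => [|i]; first exact: nbhs_filter.
apply: cvg_arrow => [|j]; first exact: nbhs_filter.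
apply: cvg_arrow => [|k]; first exact: nbhs_filter.
apply: cvg_arrow => [|l]; first exact: nbhs_filter.
have F0 : Filter (nbhs (0 : K^o)) by exact: nbhs_filter.
have h : (t * id_tensor K i j k l : K^o) @[t --> (0 : K^o)] -->
    (0 * id_tensor K i j k l : K^o).
  exact: (cvgM cvg_id (cvg_cst _)).
have := cvgD (cvg_cst (T i j k l : K^o)) h.
rewrite mul0r addr0 => h'; exact: h'.
Qed.

Lemma open_meets_det_flattening (U : set tens) : open U -> U !=set0 ->
  exists2 T, U T & \det (flattening T) != 0.
Proof.
move=> oU [T UT].
have : nbhs T U by exact: open_nbhs_nbhs.
move=> /line_cvg/nbhs_ballP[e /= e0 he].
(* Five distinct parameters; the denominators start at 2 so that all lie strictly inside the ball of
   radius [e]. *)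
pose rs : seq K := [seq e / n.+2%:R | n <- iota 0 5].
have urs : uniq rs.
  rewrite map_inj_uniq ?iota_uniq // => m n /(mulfI (lt0r_neq0 e0))/invr_inj/eqP.
  by rewrite eqr_nat => /eqP[].
have srs : (4 < size rs)%N by rewrite size_map size_iota.
have [t /mapP[n _ ->] dt] := det_flattening_line T urs srs.
exists (fun i j k l => T i j k l + e / n.+2%:R * id_tensor K i j k l) => //.
apply: he; rewrite /ball /= sub0r normrN ger0_norm.
  by rewrite ltr_pdivrMr ?ltr0n // ltr_pMr // ltr1n.
by rewrite divr_ge0 ?ler0n // ltW.
Qed.

End Topology.

Local Open Scope complex_scope.

Theorem theorem4p6 (R : realType) :
  is_maximal_rank R[i] 2 2 2 2 4 /\
  (is_typical_rank R 2 2 2 2 4 /\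
   forall r : nat, is_typical_rank R 2 2 2 2 r -> r = 4).
Proof.
have le4 (T : tensor R[i] 2 2 2 2) : (trank T <= 4)%N.
  by apply: trank_le; exact: rank_le4.
have eq4 (T : tensor R[i] 2 2 2 2) : (\det (flattening T))%R != 0%R -> trank T = 4.
  by move=> dT; apply/eqP; rewrite eqn_leq le4 trank_ge4.
(* Density applied to the whole space yields one tensor of rank 4. *)
have [T0 _ dT0] := open_meets_det_flattening (K := R[i]) openT
  (ex_intro _ (fun _ _ _ _ => 0%R) I).
split; first by split=> //; exists T0; exact: eq4.
split.
  exists [set T : tensor R[i]^o 2 2 2 2 | (\det (flattening T))%R != 0%R]%classic.
  by split; [exact: open_det_flattening | exists T0 | exact: eq4].
(* An open set of tensors of rank [r] contains one with nonsingular flattening, whose rank is 4. *)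
move=> r [U [oU U0 Ur]].
have [T UT dT] := open_meets_det_flattening oU U0.
by transitivity (trank T); [apply/esym; exact: (Ur _ UT) | exact: eq4].
Qed.
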